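(* For $\ell\in\mathbb{Z}$ and $m=0,1,2,\ldots$, with $m\ge\ell$, the following reduction formula holds true for $x\in\mathbb{R}$: $$G^{(1)}\!\left(\left.\begin{array}{c}m+1-\ell\\ 2(m+1)-\ell\end{array}\right|x\right)=(2m-\ell+1)\binom{2m-\ell}{m}\Big\{(-1)^{m-\ell}x^{\ell-2m-1}\left(H_{m-\ell}-H_m\right)\left[\mathcal{P}(\ell,m,x)-e^{x}\mathcal{P}(-\ell,m-\ell,-x)\right]+\mathcal{F}(\ell,m,x)-e^{x}\mathcal{F}(-\ell,m-\ell,-x)\Big\}.$$
   Context: $G^{(1)}\!\left(\left.\begin{array}{c}a\\ b\end{array}\right|x\right)=\frac{\partial}{\partial a}\left[{}_1F_1(a;b;x)\right]$ is the derivative of the Kummer confluent hypergeometric function with respect to its first parameter. $H_n=\sum_{k=1}^n\frac1k$ is the $n$-th harmonic number ($H_0=0$). Further, $$\mathcal{P}(s,k,z)=\sum_{n=0}^{k}\binom{k}{n}(2k-s-n)!\,z^n,\qquad \mathcal{F}(s,k,z)=\sum_{n=0}^{k}(-1)^n\binom{k}{n}\frac{d^{\,n+k-s}}{dz^{\,n+k-s}}\left[\frac{\ln z-\mathrm{Chi}(z)-\mathrm{Shi}(z)+\gamma}{z}\right],$$ where $\gamma$ is Euler's constant, and $\mathrm{Shi}(z)=\int_0^z\frac{\sinh t}{t}dt$ and $\mathrm{Chi}(z)=\gamma+\ln z+\int_0^z\frac{\cosh t-1}{t}dt$ are the hyperbolic sine and cosine integrals (with the same branch of $\ln z$ throughout,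 so that the logarithms in the bracket cancel). *)

(* Defs.v *)
From Stdlib Require Import Reals ZArith.
From Coquelicot Require Import Coquelicot.
Open Scope R_scope.

(** Rising factorial [(a)_n = a (a + 1) ... (a + n - 1)]. *)
Fixpoint pochhammer (a : R) (n : nat) : R :=
  match n with
  | O => 1
  | S p => pochhammer a p * (a + INR p)
  end.

(** Kummer's function [1F1(a; b; x)]; meaningful when [b] is not a nonpositive
    integer. *)
Definition kummer (a b x : R) : R :=
  Series (fun n => pochhammer a n / pochhammer b n * x ^ n / INR (fact n)).

Definition G1 (a b x : R) : R := Derive (fun t => kummer t b x) a.

Definition harmonic (n : nat) : R := sum_n_m (fun k => / INR k) 1 n.

Definition euler_gamma : R :=
  real (Lim_seq (fun n => harmonic n - ln (INR n))).

(** On the negative axis the branches of the logarithm differ by imaginary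
    constants, which cancel in [log_bracket].  We use the common real part
    [ln |z|] in both places. *)
Definition ln_abs (z : R) : R := ln (Rabs z).

(** The integrands below have a removable singularity at [t = 0]; their value
    there does not affect the integral. *)
Definition Shi (z : R) : R := RInt (fun t => sinh t / t) 0 z.

Definition Chi (z : R) : R :=
  euler_gamma + ln_abs z + RInt (fun t => (cosh t - 1) / t) 0 z.

(** Meaningful for [z <> 0] only. *)
Definition log_bracket (z : R) : R :=
  (ln_abs z - Chi z - Shi z + euler_gamma) / z.

(** [calP] is used only for [s <= k], so that [Z.to_nat] never truncates;
    likewise in [calF]. *)
Definition calP (s : Z) (k : nat) (z : R) : R :=
  sum_f_R0
    (fun n => Binomial.C k n
              * INR (fact (Z.to_nat (2 * Z.of_nat k - s - Z.of_nat n)))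
              * z ^ n) k.

Definition calF (s : Z) (k : nat) (z : R) : R :=
  sum_f_R0
    (fun n => (-1) ^ n * Binomial.C k n
              * Derive_n log_bracket (Z.to_nat (Z.of_nat n + Z.of_nat k - s)) z)
    k.

(* Main.v *)
(** Euler's integral and its derivative in the first parameter express [G1], with
    [p = m - l], as [(m+p+1)!/(m! p!)] times the integral over [0,1] of
    [exp (x t) t^p (1-t)^m (ln t - ln (1-t) + H_m - H_p)]. The part with [ln t] is
    [calF l m x], since [log_bracket] is the integral of [exp (x t) ln t]; the part
    with [ln (1-t)] reduces to it by [t -> 1-t]; the rest is a polynomial integrated
    against [exp (x t)].  All these integrals are handled through their power
    series in [x], whose coefficients [integral of t^i (1-t)^j] and
    [integral of t^i (1-t)^j ln t] both satisfy [f i (j+1) = f i j - f (i+1) j]. *)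

Require Import Defs.
From Stdlib Require Import Reals ZArith.
From Stdlib Require Import Lra Lia.
From Coquelicot Require Import Coquelicot.
Open Scope R_scope.

(** * Harmonic numbers, binomial sums and iterated differences *)

Lemma harmonic_S n : harmonic (S n) = harmonic n + / INR (S n).
Proof.
unfold harmonic. rewrite sum_n_Sm; [reflexivity | lia].
Qed.

Lemma harmonic_le n k : harmonic n <= harmonic (n + k).
Proof.
induction k as [|k IH]; [rewrite Nat.add_0_r; lra|].
rewrite Nat.add_succ_r, harmonic_S.
assert (0 < / INR (S (n + k))) by (apply Rinv_0_lt_compat, lt_0_INR; lia).
lra.
Qed.

(** Pascal's rule, applied to the inner terms after the two end terms have been split off. It drives
    the inductions both for differences and for [fact_sum]. *)
Lemma sum_binomial_S (n : nat) (f : nat -> R) :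
  sum_f_R0 (fun k => Binomial.C (S n) k * f k) (S n)
  = sum_f_R0 (fun k => Binomial.C n k * f k) n
    + sum_f_R0 (fun k => Binomial.C n k * f (S k)) n.
Proof.
assert (C0 : forall q, Binomial.C q 0 = 1).
{ intros q. unfold Binomial.C. rewrite Nat.sub_0_r. simpl (fact 0).
  simpl (INR 1). field. apply INR_fact_neq_0. }
assert (Cn : forall q, Binomial.C q q = 1).
{ intros q. unfold Binomial.C. rewrite Nat.sub_diag. simpl (fact 0).
  simpl (INR 1). field. apply INR_fact_neq_0. }
destruct n as [|n].
{ simpl. rewrite !C0, Cn. ring. }
rewrite (decomp_sum _ (S (S n))) by lia.
rewrite (decomp_sum (fun k => Binomial.C (S n) k * f k) (S n)) by lia.
cbn [pred]. rewrite !tech5.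
rewrite (sum_eq _ (fun k => Binomial.C (S n) (S k) * f (S k)
                            + Binomial.C (S n) k * f (S k)) n).
2:{ intros i Hi. rewrite <- pascal by lia. ring. }
rewrite sum_plus, !C0, !Cn. ring.
Qed.

(** If [f i j] is the integral of t^i (1-t)^j against a weight, [Hf] is (1-t)^(j+1) = (1-t)^j - t
    (1-t)^j, and the conclusion is the binomial expansion of (1-t)^n under the integral. *)
Lemma iterated_difference (f : nat -> nat -> R)
  (Hf : forall i j, f i (S j) = f i j - f (S i) j) (n i j : nat) :
  sum_f_R0 (fun k => (-1) ^ k * Binomial.C n k * f (i + k)%nat j) n
  = f i (j + n)%nat.
Proof.
revert i j. induction n as [|n IH]; intros i j.
{ simpl. unfold Binomial.C. simpl. rewrite !Nat.add_0_r. field. }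
rewrite (sum_eq _ (fun k => Binomial.C (S n) k * ((-1) ^ k * f (i + k)%nat j)))
  by (intros; ring).
rewrite sum_binomial_S.
rewrite (sum_eq _ (fun k => (-1) ^ k * Binomial.C n k * f (i + k)%nat j))
  by (intros; ring).
rewrite (sum_eq (fun k => Binomial.C n k * ((-1) ^ S k * f (i + S k)%nat j))
  (fun k => ((-1) ^ k * Binomial.C n k * f (S i + k)%nat j) * (-1))).
2:{ intros k _. rewrite <- plus_n_Sm. simpl. ring. }
rewrite <- scal_sum, !IH, <- plus_n_Sm, Hf. ring.
Qed.

(** * Beta integrals with and without a logarithm *)

(* [beta i j] and [log_beta i j] are the integrals over [0,1] of
   [t^i (1-t)^j] and of [t^i (1-t)^j ln t]. *)
Definition beta (i j : nat) : R :=
  INR (fact i) * INR (fact j) / INR (fact (i + j + 1)).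

Definition log_beta (i j : nat) : R :=
  beta i j * (harmonic i - harmonic (i + j + 1)).

Lemma beta_pos i j : 0 < beta i j.
Proof.
unfold beta. pose proof (INR_fact_lt_0 i). pose proof (INR_fact_lt_0 j).
pose proof (INR_fact_lt_0 (i + j + 1)).
apply Rdiv_lt_0_compat; [now apply Rmult_lt_0_compat | assumption].
Qed.

Lemma beta_comm i j : beta i j = beta j i.
Proof.
unfold beta. rewrite (Nat.add_comm i j). f_equal. ring.
Qed.

Lemma beta_S_l i j :
  beta (S i) j = beta i j * (INR i + 1) / (INR i + INR j + 2).
Proof.
unfold beta. replace (S i + j + 1)%nat with (S (i + j + 1)) by lia.
rewrite !fact_simpl, !mult_INR, !S_INR, !plus_INR. simpl (INR 1).
field. split; [apply INR_fact_neq_0|].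
pose proof (pos_INR i). pose proof (pos_INR j). lra.
Qed.

Lemma beta_difference i j : beta i (S j) = beta i j - beta (S i) j.
Proof.
rewrite beta_comm, !beta_S_l, (beta_comm j i).
pose proof (pos_INR i). pose proof (pos_INR j). field. lra.
Qed.

Lemma log_beta_difference i j :
  log_beta i (S j) = log_beta i j - log_beta (S i) j.
Proof.
unfold log_beta.
replace (i + S j + 1)%nat with (S (i + j + 1)) by lia.
replace (S i + j + 1)%nat with (S (i + j + 1)) by lia.
rewrite !harmonic_S, beta_difference, beta_S_l, !S_INR, !plus_INR.
simpl (INR 1). pose proof (pos_INR i). pose proof (pos_INR j). field.
repeat split; lra.
Qed.

Lemma beta_0_r i : beta i 0 = / (INR i + 1).
Proof.
unfold beta. replace (i + 0 + 1)%nat with (S i) by lia.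
rewrite fact_simpl, mult_INR, S_INR. simpl (fact 0). simpl (INR 1).
field. split; [|apply INR_fact_neq_0]. pose proof (pos_INR i). lra.
Qed.

Lemma log_beta_0_r i : log_beta i 0 = - / (INR i + 1) ^ 2.
Proof.
unfold log_beta. replace (i + 0 + 1)%nat with (S i) by lia.
rewrite harmonic_S, beta_0_r, S_INR. pose proof (pos_INR i). field. lra.
Qed.

Lemma inv_succ_le_1 n : 0 < / (INR n + 1) <= 1.
Proof.
pose proof (pos_INR n). split; [apply Rinv_0_lt_compat; lra|].
rewrite <- Rinv_1. apply Rinv_le_contravar; lra.
Qed.

(** By the difference relation and positivity the values decrease in [j], so the case j = 0 is the
    largest. *)
Lemma beta_le_1 i j : beta i j <= 1.
Proof.
induction j as [|j IH].
- rewrite beta_0_r. apply inv_succ_le_1.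
- rewrite beta_difference. pose proof (beta_pos (S i) j). lra.
Qed.

Lemma log_beta_neg i j : log_beta i j <= 0.
Proof.
unfold log_beta. pose proof (beta_pos i j).
pose proof (harmonic_le i (j + 1)). rewrite Nat.add_assoc in *. nra.
Qed.

(** Dually to [beta_le_1], the nonpositive values increase with [j], so the case j = 0 is the
    smallest. *)
Lemma log_beta_ge i j : -1 <= log_beta i j.
Proof.
induction j as [|j IH].
- rewrite log_beta_0_r, <- pow_inv. pose proof (inv_succ_le_1 i). nra.
- rewrite log_beta_difference. pose proof (log_beta_neg (S i) j). lra.
Qed.

(** * Exponential generating functions of bounded sequences *)

Definition egf (c : nat -> R) (x : R) : R :=
  PSeries (fun n => c n / INR (fact n)) x.

(** The integral of exp (x t) w(t) over [0,1] is the [egf] of the moments of w. Bounded moments make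
    this series entire, so linearity, products and derivatives can be taken coefficientwise. *)
Definition bounded (c : nat -> R) : Prop :=
  exists M, forall n, Rabs (c n) <= M.

Lemma egf_ext (c d : nat -> R) x : (forall n, c n = d n) -> egf c x = egf d x.
Proof.
intros H. apply PSeries_ext. intros n. now rewrite H.
Qed.

Lemma ex_series_exp_bound M x :
  ex_series (fun n => M * (Rabs x ^ n / INR (fact n))).
Proof.
apply (ex_series_scal M (fun n => Rabs x ^ n / INR (fact n))).
exists (exp (Rabs x)).
generalize (proj1 (is_pseries_R _ _ _) (is_exp_Reals (Rabs x))).
apply is_series_ext. intros n. unfold Rdiv. apply Rmult_comm.
Qed.

Lemma bounded_term_le (c M x : R) n :
  Rabs c <= M -> Rabs (c / INR (fact n) * x ^ n) <= M * (Rabs x ^ n / INR (fact n)).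
Proof.
intros H. unfold Rdiv.
rewrite !Rabs_mult, RPow_abs, (Rabs_pos_eq (/ INR (fact n))).
2:{ apply Rlt_le, Rinv_0_lt_compat, INR_fact_lt_0. }
rewrite Rmult_assoc, (Rmult_comm (/ _)).
apply Rmult_le_compat_r; [|exact H].
apply Rmult_le_pos; [apply Rabs_pos|].
apply Rlt_le, Rinv_0_lt_compat, INR_fact_lt_0.
Qed.

Lemma ex_pseries_bounded c x :
  bounded c -> ex_pseries (fun n => c n / INR (fact n)) x.
Proof.
intros [M HM]. apply ex_pseries_R.
apply (ex_series_le (V := R_CompleteNormedModule) _
  (fun n => M * (Rabs x ^ n / INR (fact n)))).
- intros n. apply bounded_term_le, HM.
- apply ex_series_exp_bound.
Qed.

Lemma CV_radius_bounded_egf c :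
  bounded c -> CV_radius (fun n => c n / INR (fact n)) = p_infty.
Proof.
intros Hc.
(* Outside the disk of convergence the terms would not tend to 0, whereas the series converges
   everywhere; a finite radius r is then refuted at r + 1. *)
assert (Hout : forall x,
  ~ Rbar_lt (CV_radius (fun n => c n / INR (fact n))) (Rabs x)).
{ intros x Hx. apply CV_disk_outside in Hx. apply Hx.
  apply ex_series_lim_0. apply (proj1 (ex_pseries_R _ _)).
  now apply ex_pseries_bounded. }
pose proof (CV_radius_ge_0 (fun n => c n / INR (fact n))) as H0.
destruct (CV_radius _) as [r| |]; [|reflexivity|easy].
exfalso. apply (Hout (r + 1)). simpl in *. rewrite Rabs_pos_eq; lra.
Qed.

Lemma CV_radius_bounded_egf_gt c y :
  bounded c -> Rbar_lt (Finite y) (CV_radius (fun n => c n / INR (fact n))).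
Proof.
intros Hc. now rewrite CV_radius_bounded_egf.
Qed.

Lemma bounded_lin c d (u v : R) :
  bounded c -> bounded d -> bounded (fun n => u * c n + v * d n).
Proof.
intros [M HM] [N HN]. exists (Rabs u * M + Rabs v * N). intros n.
eapply Rle_trans; [apply Rabs_triang|]. rewrite !Rabs_mult.
apply Rplus_le_compat; apply Rmult_le_compat_l; auto using Rabs_pos.
Qed.

Lemma egf_lin c d (u v x : R) : bounded c -> bounded d ->
  egf (fun n => u * c n + v * d n) x = u * egf c x + v * egf d x.
Proof.
intros Hc Hd. unfold egf. rewrite <- !PSeries_scal, <- PSeries_plus.
- apply PSeries_ext. intros n.
  unfold PS_plus, PS_scal, plus, scal; simpl; unfold mult; simpl.
  field. apply INR_fact_neq_0.
- apply ex_pseries_scal, ex_pseries_bounded, Hc. apply Rmult_comm.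
- apply ex_pseries_scal, ex_pseries_bounded, Hd. apply Rmult_comm.
Qed.

Lemma bounded_sum (w : nat -> R) (c : nat -> nat -> R) k :
  (forall n, bounded (c n)) ->
  bounded (fun N => sum_f_R0 (fun n => w n * c n N) k).
Proof.
intros Hc. induction k as [|k IH]; simpl.
- destruct (bounded_lin _ _ (w O) 0 (Hc O) (Hc O)) as [M HM].
  exists M. intros n. specialize (HM n).
  now replace (w O * c O n) with (w O * c O n + 0 * c O n) by ring.
- destruct (bounded_lin _ _ 1 (w (S k)) IH (Hc (S k))) as [M HM].
  exists M. intros n. specialize (HM n). now rewrite Rmult_1_l in HM.
Qed.

Lemma egf_sum (w : nat -> R) (c : nat -> nat -> R) k x :
  (forall n, bounded (c n)) ->
  egf (fun N => sum_f_R0 (fun n => w n * c n N) k) x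
  = sum_f_R0 (fun n => w n * egf (c n) x) k.
Proof.
intros Hc. induction k as [|k IH]; simpl.
- transitivity (w O * egf (c O) x + 0 * egf (c O) x); [|ring].
  rewrite <- egf_lin by auto. apply egf_ext. intros n. ring.
- rewrite <- IH, <- (Rmult_1_l (egf (fun N => sum_f_R0 _ k) x)), <- egf_lin
    by auto using bounded_sum.
  apply egf_ext. intros n. ring.
Qed.

Lemma egf_1 x : egf (fun _ => 1) x = exp x.
Proof.
apply is_pseries_unique. generalize (is_exp_Reals x). apply is_pseries_ext.
intros n. unfold Rdiv. now rewrite Rmult_1_l.
Qed.

(** This is the substitution t -> 1-t on moments: exp x times the integral of exp (-x t) w(t) is the
    integral of exp (x t) w(1-t). The Cauchy product with the exponential series expands the moments
    of (1-t)^N. *)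
Lemma exp_mult_egf_opp c x : bounded c ->
  exp x * egf c (- x)
  = egf (fun N => sum_f_R0 (fun k => (-1) ^ k * Binomial.C N k * c k) N) x.
Proof.
intros Hc.
assert (Hc' : bounded (fun n => (-1) ^ n * c n)).
{ destruct Hc as [M HM]. exists M. intros n.
  rewrite Rabs_mult, pow_1_abs, Rmult_1_l.
  apply HM. }
assert (Hopp : egf c (- x) = egf (fun n => (-1) ^ n * c n) x).
{ unfold egf, PSeries. apply Series_ext. intros n.
  replace (- x) with (-1 * x) by ring. rewrite Rpow_mult_distr.
  unfold Rdiv. ring. }
assert (H1 : bounded (fun _ => 1)).
{ exists 1. intros _. rewrite Rabs_R1. lra. }
rewrite <- egf_1, Hopp, Rmult_comm. unfold egf.
rewrite <- PSeries_mult by now apply CV_radius_bounded_egf_gt.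
apply PSeries_ext. intros N. unfold PS_mult, Rdiv.
rewrite (Rmult_comm (sum_f_R0 _ N)), scal_sum.
apply sum_eq. intros k Hk. unfold Binomial.C. field.
repeat split; apply INR_fact_neq_0.
Qed.

Lemma Derive_n_egf c k x : bounded c ->
  Derive_n (egf c) k x = egf (fun n => c (n + k)%nat) x.
Proof.
intros Hc. unfold egf.
rewrite (Derive_n_PSeries k (fun n => c n / INR (fact n)))
  by now apply CV_radius_bounded_egf_gt.
apply PSeries_ext. intros n. unfold PS_derive_n. field.
split; apply INR_fact_neq_0.
Qed.

Lemma bounded_beta (i j : nat -> nat) : bounded (fun n => beta (i n) (j n)).
Proof.
exists 1. intros n. rewrite Rabs_pos_eq.
- apply beta_le_1.
- apply Rlt_le, beta_pos.
Qed.

Lemma bounded_log_beta (i j : nat -> nat) :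
  bounded (fun n => log_beta (i n) (j n)).
Proof.
exists 1. intros n. apply Rabs_le. split; [apply log_beta_ge|].
pose proof (log_beta_neg (i n) (j n)). lra.
Qed.

(** * Closed form of the transform of t^i (1-t)^j *)

(* [calP s k] for [i = k - s]. *)
Definition fact_sum (i k : nat) (z : R) : R :=
  sum_f_R0 (fun n => Binomial.C k n * (INR (fact (k + i - n)) * z ^ n)) k.

Lemma fact_sum_S i k z :
  fact_sum i (S k) z = fact_sum (S i) k z + z * fact_sum i k z.
Proof.
unfold fact_sum. rewrite sum_binomial_S. f_equal.
- apply sum_eq. intros n Hn. now rewrite Nat.add_succ_r.
- rewrite scal_sum. apply sum_eq. intros n Hn.
  replace (S k + i - S n)%nat with (k + i - n)%nat by lia. simpl. ring.
Qed.

(** Since C(k,n) (k-n)! = k!/n!, [fact_sum 0 k] is k! times the exponential series truncated at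
    degree k. *)
Lemma fact_sum_0_l_S k z :
  fact_sum 0 (S k) z = INR (S k) * fact_sum 0 k z + z ^ S k.
Proof.
unfold fact_sum. rewrite tech5, scal_sum. f_equal.
- apply sum_eq. intros n Hn. unfold Binomial.C.
  rewrite !Nat.add_0_r. rewrite fact_simpl, mult_INR. field.
  repeat split; apply INR_fact_neq_0.
- unfold Binomial.C. rewrite Nat.add_0_r, Nat.sub_diag.
  simpl (fact 0). simpl (INR 1). field. apply INR_fact_neq_0.
Qed.

Lemma fact_sum_0_r i z : fact_sum i 0 z = INR (fact i).
Proof.
unfold fact_sum, Binomial.C. simpl. rewrite Nat.sub_0_r. field.
Qed.

(** Integration by parts in the integral of exp (x t) t^(i+1), checked on coefficients. *)
Lemma egf_beta_0_r_S i x :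
  x * egf (fun N => beta (N + S i) 0) x
  = exp x - INR (S i) * egf (fun N => beta (N + i) 0) x.
Proof.
rewrite <- egf_1.
unfold egf at 1. rewrite <- PSeries_incr_1.
rewrite <- (Rmult_1_l (egf (fun _ => 1) x)).
unfold Rminus. rewrite Ropp_mult_distr_l, <- egf_lin.
2:{ exists 1. intros _. rewrite Rabs_R1. lra. }
2:{ apply bounded_beta. }
apply PSeries_ext. intros [|n]; simpl PS_incr_1.
- rewrite beta_0_r, S_INR. simpl. unfold zero; simpl.
  pose proof (pos_INR i). field. lra.
- rewrite !beta_0_r, fact_simpl, mult_INR.
  rewrite !plus_INR, !S_INR. pose proof (pos_INR i). pose proof (pos_INR n).
  field. repeat split; try lra. apply INR_fact_neq_0.
Qed.

(** Induction on [j]: [beta_difference] on the left matches [fact_sum_S], used for both polynomials,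
    on the right. For j = 0, induction on [i] by integration by parts, started from (exp x -
    1)/x. *)
Lemma egf_beta_fact_sum i j x :
  x ^ (i + j + 1) * egf (fun N => beta (N + i) j) x
  = (-1) ^ S i * (fact_sum i j x - exp x * fact_sum j i (- x)).
Proof.
revert i. induction j as [|j IHj]; intros i.
- rewrite fact_sum_0_r. induction i as [|i IHi].
  + rewrite fact_sum_0_r.
    replace (x ^ (0 + 0 + 1)) with x by (simpl; ring).
    rewrite <- egf_1. unfold egf at 2.
    rewrite PSeries_decr_1.
    2:{ apply ex_pseries_bounded. exists 1. intros _. rewrite Rabs_R1. lra. }
    assert (HE : PSeries (PS_decr_1 (fun n => 1 / INR (fact n))) x
                 = egf (fun N => beta (N + 0) 0) x).
    { apply PSeries_ext. intros n. unfold PS_decr_1.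
      rewrite beta_0_r, Nat.add_0_r, fact_simpl, mult_INR, S_INR.
      pose proof (pos_INR n). field. split; [lra | apply INR_fact_neq_0]. }
    rewrite HE. simpl. field.
  + replace (S i + 0 + 1)%nat with (S (i + 0 + 1)) by lia.
    rewrite fact_sum_0_l_S.
    change (x ^ S (i + 0 + 1)) with (x * x ^ (i + 0 + 1)).
    rewrite Rmult_assoc, (Rmult_comm (x ^ (i + 0 + 1))), <- Rmult_assoc.
    rewrite egf_beta_0_r_S.
    transitivity (x ^ S i * exp x
      - INR (S i) * (x ^ (i + 0 + 1) * egf (fun N => beta (N + i) 0) x)).
    { replace (i + 0 + 1)%nat with (S i) by lia. ring. }
    rewrite IHi.
    replace ((- x) ^ S i) with ((-1) ^ S i * x ^ S i)
      by (rewrite <- Rpow_mult_distr; f_equal; ring).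
    rewrite (fact_simpl i), mult_INR.
    (* The boundary term x^(i+1) exp x has no sign on the left; on the right it carries the sign of
       (-x)^(i+1) times the outer sign, and the two cancel. *)
    assert (Hs : (-1) ^ S i * (-1) ^ S i = 1).
    { rewrite <- Rpow_mult_distr. replace (-1 * -1) with 1 by ring. apply pow1. }
    change ((-1) ^ S (S i)) with (-1 * (-1) ^ S i).
    transitivity (((-1) ^ S i * (-1) ^ S i) * (x ^ S i * exp x)
      - INR (S i) * ((-1) ^ S i *
          (INR (fact i) - exp x * fact_sum 0 i (- x)))).
    { rewrite Hs. ring. }
    ring.
- rewrite (egf_ext _ (fun N => 1 * beta (N + i) j + -1 * beta (N + S i) j)).
  2:{ intros N. rewrite beta_difference, <- plus_n_Sm. ring. }
  rewrite egf_lin by apply bounded_beta.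
  transitivity (x * (x ^ (i + j + 1) * egf (fun N => beta (N + i) j) x)
    - x ^ (S i + j + 1) * egf (fun N => beta (N + S i) j) x).
  { replace (i + S j + 1)%nat with (S (i + j + 1)) by lia.
    replace (S i + j + 1)%nat with (S (i + j + 1)) by lia. simpl. ring. }
  rewrite !IHj, !fact_sum_S. simpl. ring.
Qed.

(** * Differentiation of Kummer's series in its first parameter *)

Fixpoint pochhammer_deriv (a : R) (n : nat) : R :=
  match n with
  | O => 0
  | S p => pochhammer_deriv a p * (a + INR p) + pochhammer a p
  end.

Lemma pochhammer_pos a n : 0 < a -> 0 < pochhammer a n.
Proof.
intros Ha. induction n as [|n IH]; simpl pochhammer; [lra|].
apply Rmult_lt_0_compat; [assumption|]. pose proof (pos_INR n). lra.
Qed.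

Lemma pochhammer_deriv_ge_0 a n : 0 < a -> 0 <= pochhammer_deriv a n.
Proof.
intros Ha. induction n as [|n IH]; simpl; [lra|].
pose proof (pos_INR n). pose proof (pochhammer_pos a n Ha). nra.
Qed.

Lemma pochhammer_le a b n : 0 < a <= b -> pochhammer a n <= pochhammer b n.
Proof.
intros Hab. induction n as [|n IH]; simpl pochhammer; [lra|].
pose proof (pos_INR n). pose proof (pochhammer_pos a n (proj1 Hab)).
apply Rmult_le_compat; lra.
Qed.

Definition pochhammer_rem (a h : R) (n : nat) : R :=
  pochhammer (a + h) n - pochhammer a n - h * pochhammer_deriv a n.

Lemma pochhammer_rem_S a h n :
  pochhammer_rem a h (S n)
  = h ^ 2 * pochhammer_deriv a n + pochhammer_rem a h n * (a + h + INR n).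
Proof.
unfold pochhammer_rem. simpl. ring.
Qed.

(* [(a + h)_n] is a polynomial in [h] with nonnegative coefficients, so its
   Taylor remainder of order 2 at [h], divided by [h^2], is largest at [h = 1]. *)
Lemma pochhammer_rem_bound a h n : 0 < a -> Rabs h <= 1 ->
  Rabs (pochhammer_rem a h n) <= h ^ 2 * pochhammer_rem a 1 n.
Proof.
intros Ha Hh. induction n as [|n IH].
- unfold pochhammer_rem; simpl. rewrite !Rmult_0_r, !Rminus_0_r, Rminus_diag.
  rewrite Rabs_R0. lra.
- rewrite !pochhammer_rem_S.
  eapply Rle_trans; [apply Rabs_triang|].
  pose proof (pochhammer_deriv_ge_0 a n Ha) as Hd.
  pose proof (pos_INR n) as Hn.
  rewrite !Rabs_mult, (Rabs_pos_eq (pochhammer_deriv a n)) by assumption.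
  rewrite (Rabs_pos_eq (h ^ 2)) by apply pow2_ge_0.
  rewrite pow1, Rmult_1_l, Rmult_plus_distr_l, <- Rmult_assoc.
  apply Rplus_le_compat_l, Rmult_le_compat; try apply Rabs_pos; [assumption|].
  apply Rabs_le. apply Rabs_le_between in Hh. lra.
Qed.

(** All three summands are nonnegative when a > 0, so each is at most [pochhammer (a + 1) n], hence
    at most [pochhammer b n] once a + 1 <= b. This gives bounds uniform in [n]. *)
Lemma pochhammer_split a n :
  pochhammer (a + 1) n
  = pochhammer a n + pochhammer_deriv a n + pochhammer_rem a 1 n.
Proof.
unfold pochhammer_rem. ring.
Qed.

Lemma pochhammer_rem_1_ge_0 a n : 0 < a -> 0 <= pochhammer_rem a 1 n.
Proof.
intros Ha. pose proof (pochhammer_rem_bound a 1 n Ha) as H.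
rewrite Rabs_R1 in H. specialize (H (Rle_refl 1)).
pose proof (Rabs_pos (pochhammer_rem a 1 n)). lra.
Qed.

Lemma Rabs_div_le_1 u v : Rabs u <= v -> 0 < v -> Rabs (u / v) <= 1.
Proof.
intros Hu Hv. rewrite Rabs_div, (Rabs_pos_eq v) by lra.
apply Rle_div_l; lra.
Qed.

Lemma kummer_egf t b x :
  kummer t b x = egf (fun n => pochhammer t n / pochhammer b n) x.
Proof.
unfold kummer, egf, PSeries. apply Series_ext. intros n. unfold Rdiv. ring.
Qed.

Lemma egf_bound c M x : (forall n, Rabs (c n) <= M) ->
  Rabs (egf c x) <= M * exp (Rabs x).
Proof.
intros HM.
assert (HS : Series (fun n => M * (Rabs x ^ n / INR (fact n)))
             = M * exp (Rabs x)).
{ rewrite Series_scal_l, <- egf_1. f_equal. apply Series_ext. intros n.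
  unfold Rdiv. ring. }
rewrite <- HS. unfold egf, PSeries.
eapply Rle_trans; [apply Series_Rabs|].
- apply (ex_series_le (V := R_CompleteNormedModule) _
    (fun n => M * (Rabs x ^ n / INR (fact n)))).
  + intros n. unfold norm; simpl; unfold abs; simpl. rewrite Rabs_Rabsolu.
    apply bounded_term_le, HM.
  + apply ex_series_exp_bound.
- apply Series_le.
  + intros n. split; [apply Rabs_pos|]. apply bounded_term_le, HM.
  + apply ex_series_exp_bound.
Qed.

Section KummerDerivative.

Variables a b : R.
Hypothesis Ha : 0 < a.
Hypothesis Hab : a + 1 <= b.

Lemma bounded_pochhammer_ratio (u : nat -> R) :
  (forall n, Rabs (u n) <= pochhammer (a + 1) n) ->
  forall n, Rabs (u n / pochhammer b n) <= 1.
Proof.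
intros Hu n. apply Rabs_div_le_1.
- eapply Rle_trans; [apply Hu | apply pochhammer_le; lra].
- apply pochhammer_pos. lra.
Qed.

Lemma pochhammer_deriv_ratio n :
  Rabs (pochhammer_deriv a n / pochhammer b n) <= 1.
Proof.
revert n. apply bounded_pochhammer_ratio. intros n.
rewrite pochhammer_split, Rabs_pos_eq by now apply pochhammer_deriv_ge_0.
pose proof (pochhammer_pos a n Ha). pose proof (pochhammer_rem_1_ge_0 a n Ha).
lra.
Qed.

Lemma pochhammer_ratio n : Rabs (pochhammer a n / pochhammer b n) <= 1.
Proof.
revert n. apply bounded_pochhammer_ratio. intros n.
pose proof (pochhammer_pos a n Ha).
rewrite Rabs_pos_eq by lra. apply pochhammer_le. lra.
Qed.

Lemma pochhammer_rem_ratio h n : Rabs h <= 1 ->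
  Rabs (pochhammer_rem a h n / pochhammer b n) <= h ^ 2.
Proof.
intros Hh. pose proof (pochhammer_rem_bound a h n Ha Hh) as H.
assert (Hb : 0 < pochhammer b n) by (apply pochhammer_pos; lra).
rewrite Rabs_div, (Rabs_pos_eq (pochhammer b n)) by lra.
apply Rle_div_l; [lra|]. eapply Rle_trans; [exact H|].
apply Rmult_le_compat_l; [apply pow2_ge_0|].
apply Rle_trans with (pochhammer (a + 1) n); [|apply pochhammer_le; lra].
rewrite pochhammer_split. pose proof (pochhammer_pos a n Ha).
pose proof (pochhammer_deriv_ge_0 a n Ha). lra.
Qed.

(** Expanding each coefficient to first order in [h], the error of the difference quotient is the
    [egf] of the remainders divided by [h]. The remainder ratios are at most h^2, so the error is at
    most |h| exp |x|. *)
Lemma is_derive_kummer x :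
  is_derive (fun t => kummer t b x) a
    (egf (fun n => pochhammer_deriv a n / pochhammer b n) x).
Proof.
apply is_derive_Reals. intros eps Heps.
set (E := exp (Rabs x)). assert (HE : 0 < E) by apply exp_pos.
(* The bound 1 allows the remainder estimate; [eps / E] makes |h| E smaller than [eps]. *)
assert (Hd : 0 < Rmin 1 (eps / E)).
{ apply Rmin_pos; [lra|]. now apply Rdiv_lt_0_compat. }
exists (mkposreal _ Hd). simpl. intros h Hh0 Hh.
assert (Hh1 : Rabs h <= 1).
{ pose proof (Rmin_l 1 (eps / E)). lra. }
rewrite !kummer_egf.
assert (Hc0 : bounded (fun n => pochhammer a n / pochhammer b n))
  by (exists 1; apply pochhammer_ratio).
assert (Hc1 : bounded (fun n => pochhammer_deriv a n / pochhammer b n))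
  by (exists 1; apply pochhammer_deriv_ratio).
assert (Hc2 : bounded (fun n => pochhammer_rem a h n / pochhammer b n))
  by (exists (h ^ 2); intros n; now apply pochhammer_rem_ratio).
rewrite (egf_ext (fun n => pochhammer (a + h) n / pochhammer b n)
  (fun n => 1 * (1 * (pochhammer a n / pochhammer b n)
                 + h * (pochhammer_deriv a n / pochhammer b n))
            + 1 * (pochhammer_rem a h n / pochhammer b n))).
2:{ intros n. unfold pochhammer_rem, Rdiv. ring. }
rewrite egf_lin, egf_lin by auto using bounded_lin.
match goal with |- Rabs ?e < _ =>
  replace e with (egf (fun n => pochhammer_rem a h n / pochhammer b n) x / h)
    by now field
end.
rewrite Rabs_div by assumption.
assert (Hhp : 0 < Rabs h) by now apply Rabs_pos_lt.
apply Rlt_div_l; [assumption|].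
apply Rle_lt_trans with (h ^ 2 * E).
- apply egf_bound. intros n. now apply pochhammer_rem_ratio.
- rewrite <- (pow2_abs h). simpl. rewrite Rmult_1_r, Rmult_assoc.
  rewrite (Rmult_comm eps). apply Rmult_lt_compat_l; [assumption|].
  apply Rlt_div_r; [assumption|].
  eapply Rlt_le_trans; [exact Hh | apply Rmin_r].
Qed.

End KummerDerivative.

(** * Pochhammer symbols at positive integers *)

Lemma pochhammer_succ p n :
  pochhammer (INR (S p)) n = INR (fact (p + n)) / INR (fact p).
Proof.
induction n as [|n IH]; cbn [pochhammer].
- rewrite Nat.add_0_r. field. apply INR_fact_neq_0.
- rewrite IH, <- plus_n_Sm, fact_simpl, mult_INR, !S_INR, plus_INR. field.
  apply INR_fact_neq_0.
Qed.

(** The logarithmic derivative of the rising factorial is the sum of 1/(p+1+k) for k < n, a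
    difference of harmonic numbers. *)
Lemma pochhammer_deriv_succ p n :
  pochhammer_deriv (INR (S p)) n
  = pochhammer (INR (S p)) n * (harmonic (p + n) - harmonic p).
Proof.
induction n as [|n IH].
- rewrite Nat.add_0_r. simpl. ring.
- cbn [pochhammer pochhammer_deriv]. rewrite IH, <- plus_n_Sm, harmonic_S.
  rewrite !S_INR, plus_INR. pose proof (pos_INR p). pose proof (pos_INR n).
  field. lra.
Qed.

(** * The logarithmic bracket and the functions F *)

Lemma mul_expm1_series t :
  t * PSeries (fun n => / INR (fact (S n))) t = exp t - 1.
Proof.
rewrite <- egf_1. unfold egf.
rewrite (PSeries_decr_1 (fun n => 1 / INR (fact n))).
2:{ apply ex_pseries_bounded. exists 1. intros _. rewrite Rabs_R1. lra. }
replace (PSeries (PS_decr_1 (fun n => 1 / INR (fact n))) t)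
  with (PSeries (fun n => / INR (fact (S n))) t).
- simpl. field.
- apply PSeries_ext. intros n. unfold PS_decr_1, Rdiv. ring.
Qed.

Lemma CV_radius_expm1_series : CV_radius (fun n => / INR (fact (S n))) = p_infty.
Proof.
rewrite (CV_radius_ext _ (PS_decr_1 (fun n => 1 / INR (fact n)))).
- rewrite CV_radius_decr_1. apply CV_radius_bounded_egf.
  exists 1. intros _. rewrite Rabs_R1. lra.
- intros n. unfold PS_decr_1, Rdiv. ring.
Qed.

(** The logarithms and Euler's constant cancel, leaving -1/z times the integral from 0 to z of (exp
    t - 1)/t, which is integrated term by term. *)
Lemma log_bracket_egf z : z <> 0 ->
  log_bracket z = egf (fun n => log_beta n 0) z.
Proof.
intros Hz.
(* Coefficients of (exp t - 1)/t, whose power series also covers t = 0. *)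
set (e := fun n => / INR (fact (S n))).
assert (Hr : forall y, Rbar_lt (Finite y) (CV_radius e)).
{ intros y. unfold e. now rewrite CV_radius_expm1_series. }
assert (Hcont : forall t, continuous (PSeries e) t).
{ intros t. apply continuity_pt_filterlim, PSeries_continuity, Hr. }
assert (Hcont' : forall t, continuous (fun t => PSeries e (- t)) t).
{ intros t. apply (continuous_comp Ropp (PSeries e)); [|apply Hcont].
  apply (continuous_opp (V := R_NormedModule)), continuous_id. }
(* The even part [s] and odd part [c] of this series continuously extend sinh t / t and (cosh t -
   1)/t; their sum is the series itself. *)
set (s := fun t => (PSeries e t + PSeries e (- t)) / 2).
set (c := fun t => (PSeries e t - PSeries e (- t)) / 2).
assert (Is : ex_RInt s 0 z).
{ apply (ex_RInt_continuous (V := R_CompleteNormedModule)). intros t _.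
  apply (continuous_mult (fun t => PSeries e t + PSeries e (- t)));
    [|apply continuous_const].
  now apply (continuous_plus (V := R_NormedModule)). }
assert (Ic : ex_RInt c 0 z).
{ apply (ex_RInt_continuous (V := R_CompleteNormedModule)). intros t _.
  apply (continuous_mult (fun t => PSeries e t - PSeries e (- t)));
    [|apply continuous_const].
  now apply (continuous_minus (V := R_NormedModule)). }
(* [RInt_ext] compares integrands on the open interval only, so the value at the singular endpoint 0
   is irrelevant. *)
assert (Hne : forall t, Rmin 0 z < t < Rmax 0 z -> t <> 0).
{ intros t. unfold Rmin, Rmax. destruct (Rle_dec 0 z); lra. }
assert (HS : Shi z = RInt s 0 z).
{ apply RInt_ext. intros t Ht. apply Hne in Ht.
  pose proof (mul_expm1_series t) as H1.
  pose proof (mul_expm1_series (- t)) as H2.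
  apply (Rmult_eq_reg_l t); [|assumption].
  unfold sinh, s. fold e in H1, H2.
  transitivity ((exp t - exp (- t)) / 2); [now field | lra]. }
assert (HC : RInt (fun t => (cosh t - 1) / t) 0 z = RInt c 0 z).
{ apply RInt_ext. intros t Ht. apply Hne in Ht.
  pose proof (mul_expm1_series t) as H1.
  pose proof (mul_expm1_series (- t)) as H2.
  apply (Rmult_eq_reg_l t); [|assumption].
  unfold cosh, c. fold e in H1, H2.
  transitivity ((exp t + exp (- t)) / 2 - 1); [now field | lra]. }
assert (HSC : RInt c 0 z + RInt s 0 z = z * PSeries (PS_decr_1 (PS_Int e)) z).
{ rewrite <- PSeries_incr_1.
  transitivity (RInt (PSeries e) 0 z).
  - symmetry. rewrite (RInt_ext (PSeries e) (fun t => plus (c t) (s t))).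
    + now apply (RInt_plus (V := R_CompleteNormedModule)).
    + intros t _. unfold plus, c, s; simpl. field.
  - rewrite RInt_PSeries by apply Hr. apply PSeries_ext.
    intros [|n]; reflexivity. }
unfold log_bracket, Chi. rewrite HS, HC.
transitivity (- PSeries (PS_decr_1 (PS_Int e)) z).
- apply (Rmult_eq_reg_l z); [|assumption].
  transitivity (- (RInt c 0 z + RInt s 0 z)); [now field | rewrite HSC; ring].
- rewrite <- PSeries_opp. apply PSeries_ext. intros n.
  change (- (/ INR (fact (S n)) / INR (S n)) = log_beta n 0 / INR (fact n)).
  rewrite log_beta_0_r, fact_simpl, mult_INR, S_INR.
  pose proof (pos_INR n). field. split; [lra | apply INR_fact_neq_0].
Qed.

Lemma Derive_n_log_bracket k z : z <> 0 ->
  Derive_n log_bracket k z = egf (fun n => log_beta (n + k) 0) z.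
Proof.
intros Hz.
rewrite <- (Derive_n_egf (fun n => log_beta n 0))
  by apply (bounded_log_beta (fun n => n) (fun _ => O)).
apply Derive_n_ext_loc.
(* The series identity holds off 0 only; the ball of radius |z| around [z] avoids 0. *)
assert (Hz' : 0 < Rabs z) by now apply Rabs_pos_lt.
exists (mkposreal _ Hz'). intros y Hy. apply log_bracket_egf.
intros ->. unfold ball, AbsRing_ball, abs, minus in Hy. simpl in Hy.
unfold AbsRing_ball, abs, minus, plus, opp in Hy. simpl in Hy.
rewrite Rplus_0_l, Rabs_Ropp in Hy. lra.
Qed.

(** Each derivative of the bracket multiplies the integrand by t, so the alternating binomial sum
    produces the factor (1-t)^k: this is the transform of t^q (1-t)^k ln t. *)
Lemma calF_egf (s : Z) (k q : nat) z :
  (Z.of_nat k - s = Z.of_nat q)%Z -> z <> 0 ->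
  calF s k z = egf (fun N => log_beta (N + q) k) z.
Proof.
intros Hq Hz. unfold calF.
rewrite (sum_eq _ (fun n => (-1) ^ n * Binomial.C k n
                            * egf (fun N => log_beta (N + (n + q)) 0) z)).
2:{ intros n Hn. rewrite Derive_n_log_bracket by assumption.
    now replace (Z.to_nat (Z.of_nat n + Z.of_nat k - s)) with (n + q)%nat by lia. }
rewrite <- (egf_sum (fun n => (-1) ^ n * Binomial.C k n)
  (fun n N => log_beta (N + (n + q)) 0)).
2:{ intros n. apply bounded_log_beta. }
apply egf_ext. intros N.
rewrite <- (Nat.add_0_l k) at 2.
rewrite <- (iterated_difference log_beta log_beta_difference).
apply sum_eq. intros n Hn. do 2 f_equal. lia.
Qed.

(** * The functions P, and assembly of the formula *)

Lemma calP_fact_sum (s : Z) (k q : nat) z :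
  (Z.of_nat k - s = Z.of_nat q)%Z -> calP s k z = fact_sum q k z.
Proof.
intros Hq. apply sum_eq. intros n Hn.
replace (Z.to_nat (2 * Z.of_nat k - s - Z.of_nat n)) with (k + q - n)%nat by lia.
ring.
Qed.

(** [Derive] is total, so differentiability is asserted separately. At x = 0 the right side has a
    negative power and the bracket is singular; the formula is read there as a limit. *)
Theorem corollary18 (l : Z) (m : nat) (Hlm : (l <= Z.of_nat m)%Z) :
  let a := IZR (Z.of_nat m + 1 - l) in
  let b := IZR (2 * (Z.of_nat m + 1) - l) in
  let ml := Z.to_nat (Z.of_nat m - l) in
  let rhs := fun x : R =>
    IZR (2 * Z.of_nat m - l + 1)
    * Binomial.C (Z.to_nat (2 * Z.of_nat m - l)) m
    * ((-1) ^ ml * powerRZ x (l - 2 * Z.of_nat m - 1)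
         * (harmonic ml - harmonic m)
         * (calP l m x - exp x * calP (- l) ml (- x))
       + calF l m x - exp x * calF (- l) ml (- x)) in
  (forall x : R, ex_derive (fun t => kummer t b x) a) /\
  (forall x : R, x <> 0 -> G1 a b x = rhs x) /\
  is_lim rhs 0 (G1 a b 0).
Proof.
intros a b p rhs.
assert (Hp : Z.of_nat p = (Z.of_nat m - l)%Z) by (unfold p; lia).
assert (Ea : a = INR (S p)).
{ unfold a. rewrite INR_IZR_INZ. f_equal. lia. }
assert (Eb : b = INR (S (S (m + p)))).
{ unfold b. rewrite INR_IZR_INZ. f_equal. lia. }
assert (Ha : 0 < a) by (rewrite Ea; apply lt_0_INR; lia).
assert (Hab : a + 1 <= b).
{ rewrite Ea, Eb, <- S_INR. apply le_INR. lia. }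
clearbody p.
set (c := fun n => pochhammer_deriv a n / pochhammer b n).
assert (HG : forall x, G1 a b x = egf c x).
{ intros x. apply is_derive_unique. now apply is_derive_kummer. }
assert (Hrhs : forall x, x <> 0 -> egf c x = rhs x).
{ intros x Hx. unfold rhs.
  rewrite (calP_fact_sum l m p) by lia.
  rewrite (calP_fact_sum (- l) p m) by lia.
  rewrite (calF_egf l m p), (calF_egf (- l) p m) by (lia || lra).
  replace (IZR (2 * Z.of_nat m - l + 1)) with (INR (S (m + p))).
  2:{ rewrite INR_IZR_INZ. f_equal. lia. }
  replace (Z.to_nat (2 * Z.of_nat m - l)) with (m + p)%nat by lia.
  replace (powerRZ x (l - 2 * Z.of_nat m - 1)) with (/ x ^ (p + m + 1)).
  2:{ replace (l - 2 * Z.of_nat m - 1)%Z with (- Z.of_nat (p + m + 1))%Z by lia.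
      now rewrite powerRZ_neg', <- pow_powerRZ. }
  (* The closed form carries (-1)^(p+1) where the theorem has (-1)^p, whence the minus sign. *)
  assert (HP : (-1) ^ p * / x ^ (p + m + 1)
               * (fact_sum p m x - exp x * fact_sum m p (- x))
               = - egf (fun N => beta (N + p) m) x).
  { pose proof (egf_beta_fact_sum p m x) as H. simpl in H.
    apply (Rmult_eq_reg_l (x ^ (p + m + 1))); [|now apply pow_nonzero].
    rewrite <- Ropp_mult_distr_r, H. field. now apply pow_nonzero. }
  rewrite exp_mult_egf_opp by apply bounded_log_beta.
  (* After reflection the second F is the transform of t^p (1-t)^m ln (1-t), with moments
     [log_beta m (p + N)]. *)
  rewrite (egf_ext (fun N => sum_f_R0 _ N) (fun N => log_beta m (p + N))).
  2:{ intros N. rewrite <- iterated_difference by apply log_beta_difference.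
      apply sum_eq. intros k Hk. do 2 f_equal. lia. }
  (* [K] is (m+p+1)!/(m! p!), the normalising constant of Euler's integral. *)
  set (K := INR (S (m + p)) * Binomial.C (m + p) m).
  transitivity (K * ((harmonic m - harmonic p) * egf (fun N => beta (N + p) m) x
    + 1 * (1 * egf (fun N => log_beta (N + p) m) x
           + -1 * egf (fun N => log_beta m (p + N)) x))).
  - rewrite <- (egf_lin (fun N => log_beta (N + p) m)) by apply bounded_log_beta.
    rewrite <- egf_lin by (apply bounded_beta ||
      apply bounded_lin; apply bounded_log_beta).
    (* In the N-th coefficient, H_m and H_(N+p+m+1) cancel between the three terms. What remains is
       H_(N+p) - H_p, the factor in [pochhammer_deriv_succ]. *)
    unfold egf. rewrite <- PSeries_scal. apply PSeries_ext. intros N.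
    unfold PS_scal, scal; simpl; unfold mult; simpl.
    unfold c, log_beta.
    rewrite (beta_comm m (p + N)), (Nat.add_comm p N).
    replace (m + (N + p) + 1)%nat with (N + p + m + 1)%nat by lia.
    rewrite Ea, Eb, pochhammer_deriv_succ, !pochhammer_succ.
    unfold beta, K, Binomial.C.
    replace (m + p - m)%nat with p by lia.
    replace (S (m + p) + N)%nat with (N + p + m + 1)%nat by lia.
    rewrite (Nat.add_comm p N), (fact_simpl (m + p)), mult_INR.
    field.
    repeat split; try apply INR_fact_neq_0. apply not_0_INR. lia.
  - replace ((-1) ^ p * / x ^ (p + m + 1) * (harmonic p - harmonic m)
      * (fact_sum p m x - exp x * fact_sum m p (- x)))
      with (((-1) ^ p * / x ^ (p + m + 1)
        * (fact_sum p m x - exp x * fact_sum m p (- x)))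
        * (harmonic p - harmonic m)) by ring.
    rewrite HP. ring. }
repeat split.
- intros x. eexists. now apply is_derive_kummer.
- intros x Hx. rewrite HG. now apply Hrhs.
(* Off 0 the right side equals the entire function [egf c], so continuity of the latter gives the
   limit. *)
- rewrite HG. apply (is_lim_ext_loc (egf c)).
  + exists (mkposreal 1 Rlt_0_1). intros y _ Hy. now apply Hrhs.
  + apply is_lim_continuity, PSeries_continuity, CV_radius_bounded_egf_gt.
    exists 1. now apply pochhammer_deriv_ratio.
Qed.
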